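(* Let $a_1,\dots,a_n$ be positive integers with $a_1\ge 2$, let $\ell_0=0$ and $\ell_i=a_1+\cdots+a_i$. For $1\le i\le n$ define $$C_i=\begin{cases}\displaystyle\prod_{j=1}^{\ell_{i-1}} y_j & i \text{ odd},\\[1.5ex] \displaystyle\prod_{j=1}^{\ell_i-1} y_j^{-1} & i \text{ even},\end{cases}\qquad \varphi_i=\begin{cases}\displaystyle\sum_{k=\ell_{i-1}}^{\ell_i-1}\ \prod_{j=\ell_{i-1}+1}^{k} y_j & i \text{ odd},\\[2ex] \displaystyle\sum_{k=\ell_{i-1}+1}^{\ell_i}\ \prod_{j=k}^{\ell_i-1} y_j & i \text{ even},\end{cases}$$ (empty products equal $1$) and $\mathcal{L}_i=\varphi_iC_i$. Define $N[\,]=1$, $N[\mathcal{L}_1]=\mathcal{L}_1$ and recursively $N[\mathcal{L}_1,\dots,\mathcal{L}_m]=\mathcal{L}_m N[\mathcal{L}_1,\dots,\mathcal{L}_{m-1}]+N[\mathcal{L}_1,\dots,\mathcal{L}_{m-2}]$. Then the $F$-polynomial of the snake graph $\mathcal{G}[a_1,\dots,a_n]$ is $$F(\mathcal{G}[a_1,\dots,a_n])=\begin{cases} N[\mathcal{L}_1,\dots,\mathcal{L}_n] & \text{if } n \text{ is odd},\\ C_n^{-1}\,N[\mathcal{L}_1,\dots,\mathcal{L}_n] & \text{if } n \text{ is even}.\end{cases}$$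
   Context: $y_1,y_2,\dots$ are indeterminates. A tile is a unit square in the plane with edges parallel to the axes (north, south, east, west edges). A snake graph is a planar graph formed by a sequence of tiles $G_1,\dots,G_d$ where each $G_{j+1}$ is glued either to the east (right) or to the north (top) of $G_j$, so that $G_j$ and $G_{j+1}$ share exactly one edge $e_j$; $e_1,\dots,e_{d-1}$ are the interior edges, all other edges are boundary edges. A perfect matching is a set of edges such that each vertex is incident to exactly one of them. The snake graph $\mathcal{G}[a_1,\dots,a_n]$: set $d=\ell_n-1$; let $e_0$ be the south edge of $G_1$; for $0\le j\le d$ let $s_j=+$ if $\ell_{i-1}\le j<\ell_i$ with $i$ odd and $s_j=-$ if this holds with $i$ even. The tiles are placed so that, for each $1\le j\le d-1$, inside tile $G_j$ the edges $e_{j-1}$ and $e_j$ are opposite sides of $G_j$ if $s_{j-1}\ne s_j$ and adjacent sides if $s_{j-1}=s_j$ (so if $e_{j-1}$ is the south edge of $G_j$, then $e_j$ is its north edge when $s_{j-1}\neq s_j$ and its east edge otherwise; if $e_{j-1}$ is the west edge of $G_j$, then $e_j$ is its east edge when $s_{j-1}\ne s_j$ and its north edge otherwise). Tile $G_j$ carries the label $j$. The graph has exactly two perfect matchings consisting only of boundary edges; the minimal perfect matching $P_-$ is the one containing the south edge of $G_1$. For a perfect matching $P$, its height is $y(P)=\prod y_j$ over all tiles $G_j$ enclosed by the symmetric difference $P\ominus P_-$ (so $y(P_-)=1$), and the $F$-polynomial is $F(\mathcal{G}[a_1,\dots,a_n])=\sum_P y(P)$, summed over all perfect matchings $P$. 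*)

(* Defs.v *)
From mathcomp Require Import all_boot all_order all_algebra.
From mathcomp Require Import finmap.
From mathcomp Require Import mpoly.

Set Implicit Arguments.
Unset Strict Implicit.
Unset Printing Implicit Defensive.

Import GRing.Theory.

Local Open Scope fset_scope.

(* The composition [a_1, ..., a_n] is a sequence [a : seq nat]; n = size a. *)

Definition ell (a : seq nat) (i : nat) : nat := sumn (take i a).

Definition num_tiles (a : seq nat) : nat := (ell a (size a)).-1.

(* [sgn a j] is true iff s_j = +, that is, j lies in [l_(i-1), l_i[ for an
   odd i. *)
Definition sgn (a : seq nat) (j : nat) : bool :=
  has (fun i => odd i && (ell a i.-1 <= j < ell a i)) (iota 1 (size a)).

(* [glued_south a j] is true if e_j is the south edge of G_(j+1) (and, for
   j >= 1, the north edge of G_j), and false if e_j is the west edge of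
   G_(j+1) (and the east edge of G_j). *)
Fixpoint glued_south (a : seq nat) (j : nat) : bool :=
  if j is i.+1 then
    let same_sign := sgn a i == sgn a j in
    if glued_south a i
    then ~~ same_sign (* e_(j-1) is south in G_j: e_j is east iff s_(j-1) = s_j *)
    else same_sign    (* e_(j-1) is west in G_j: e_j is north iff s_(j-1) = s_j *)
  else true.

(* Vertices are points of the integer lattice; an edge is the pair of its
   endpoints, the southern (resp. western) one coming first. *)
Notation vertex := (nat * nat)%type.
Notation edge := (vertex * vertex)%type.

Definition incident (v : vertex) (e : edge) : bool := (v == e.1) || (v == e.2).

(* The edges of the unit square whose south-west corner is c. *)
Definition south (c : vertex) : edge := (c, (c.1.+1, c.2)).
Definition west (c : vertex) : edge := (c, (c.1, c.2.+1)).
Definition north (c : vertex) : edge := ((c.1, c.2.+1), (c.1.+1, c.2.+1)).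
Definition east (c : vertex) : edge := ((c.1.+1, c.2), (c.1.+1, c.2.+1)).

Definition square_edges (c : vertex) : {fset edge} :=
  [fset south c; west c; north c; east c].

(* South-west corner of the tile G_(k+1). *)
Fixpoint corner (a : seq nat) (k : nat) : vertex :=
  if k is i.+1 then
    let c := corner a i in
    if glued_south a k then (c.1, c.2.+1) else (c.1.+1, c.2)
  else (0, 0).

Section SnakeGraph.

Variable a : seq nat.

Local Notation d := (num_tiles a).

(* The index [k : 'I_d] stands for the tile G_(k+1). *)
Definition tile_edges (k : 'I_d) : {fset edge} := square_edges (corner a k).

Definition snake_edges : {fset edge} :=
  \big[@fsetU _/fset0]_(k < d) tile_edges k.

Definition snake_vertices : {fset vertex} :=
  [fset e.1 | e in snake_edges] `|` [fset e.2 | e in snake_edges].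

Definition glue_edge (j : nat) : edge :=
  if glued_south a j then south (corner a j) else west (corner a j).

Definition interior_edges : {fset edge} :=
  [fset e in [seq glue_edge j | j <- iota 1 d.-1]].

Definition boundary_edges : {fset edge} := snake_edges `\` interior_edges.

Definition perfect_matching (P : {fset edge}) : bool :=
  (P `<=` snake_edges) &&
  all (fun v => #|` [fset e in P | incident v e]| == 1) snake_vertices.

Definition perfect_matchings : {fset {fset edge}} :=
  [fset P in fpowerset snake_edges | perfect_matching P].

Definition is_minimal_matching (P : {fset edge}) : bool :=
  [&& perfect_matching P, P `<=` boundary_edges & south (corner a 0) \in P].

(* The unique perfect matching satisfying [is_minimal_matching]. *)
Definition minimal_matching : {fset edge} :=
  head fset0 [seq P <- perfect_matchings | is_minimal_matching P].

Definition symdiff (P Q : {fset edge}) : {fset edge} :=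
  (P `\` Q) `|` (Q `\` P).

(* The faces of the plane graph: [Some k] is the tile G_(k+1) and [None] the
   unbounded face. *)
Definition face_edges (f : option 'I_d) : {fset edge} :=
  if f is Some k then tile_edges k else boundary_edges.

Definition adjacent_off (S : {fset edge}) : rel (option 'I_d) :=
  fun f g => (face_edges f `&` face_edges g) `\` S != fset0.

(* A tile is enclosed by S if every path from it to the unbounded face
   crosses an edge of S. *)
Definition enclosed (S : {fset edge}) (k : 'I_d) : bool :=
  ~~ connect (adjacent_off S) (Some k) None.

(* The indeterminates are y_1, ..., y_d, with y_j = 'X_j; there is also an
   unused variable of index 0. *)
Definition y (j : nat) : {mpoly int[d.+1]} := 'X_(inord j).

Local Open Scope ring_scope.

Definition height (P : {fset edge}) : {mpoly int[d.+1]} :=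
  \prod_(k < d | enclosed (symdiff P minimal_matching) k) y k.+1.

Definition F_polynomial : {mpoly int[d.+1]} :=
  \sum_(P <- perfect_matchings) height P.

Definition yfrac (j : nat) : {fraction {mpoly int[d.+1]}} := tofrac (y j).

Definition C (i : nat) : {fraction {mpoly int[d.+1]}} :=
  if odd i then \prod_(1 <= j < (ell a i.-1).+1) yfrac j
  else \prod_(1 <= j < ell a i) (yfrac j)^-1.

Definition phi (i : nat) : {fraction {mpoly int[d.+1]}} :=
  if odd i then
    \sum_(ell a i.-1 <= k < ell a i)
      \prod_((ell a i.-1).+1 <= j < k.+1) yfrac j
  else
    \sum_((ell a i.-1).+1 <= k < (ell a i).+1) \prod_(k <= j < ell a i) yfrac j.

Definition L (i : nat) : {fraction {mpoly int[d.+1]}} := phi i * C i.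

End SnakeGraph.

(* [continuant x m] is N[x_1, ..., x_m]. *)
Fixpoint continuant (K : nzRingType) (x : nat -> K) (m : nat) : K :=
  match m with
  | 0 => 1
  | 1 => x 1%N
  | (m2.+1 as m1).+1 => x m * continuant x m1 + continuant x m2
  end%R.

(* Main.v *)
Require Import Defs.
From mathcomp Require Import all_boot all_order all_algebra.
From mathcomp Require Import finmap.
From mathcomp Require Import mpoly.
From mathcomp Require Import zify ring.

Set Implicit Arguments.
Unset Strict Implicit.
Unset Printing Implicit Defensive.

(* The vertices of the snake graph lie on the antidiagonals 0, ..., d+1, with
   two vertices on each antidiagonal except the extreme ones, and every edge
   joins consecutive antidiagonals.  Hence a perfect matching has exactly one
   edge between any two consecutive antidiagonals and amounts to the choice,
   on each antidiagonal, of the vertex matched downwards.  Comparing this with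
   P_-, the perfect matchings correspond to the sets T of enclosed tiles such
   that, for 1 <= j < d, G_(j+1) in T implies G_j in T if s_j = +, and G_j in T
   implies G_(j+1) in T if s_j = -.  So F is computed by a 2 x 2 transfer
   matrix along the tiles, and multiplying these matrices over the block of
   indices j with l_(i-1) <= j < l_i yields the i-th step of the continuant
   recursion. *)

Import GRing.Theory.
Local Open Scope fset_scope.

(** * The layers of a snake graph *)

(* u = true stands for the north-west vertex of the antidiagonal, u = false for
   the south-east one; u is ignored for m = 0. *)
Definition layer_point (a : seq nat) (m : nat) (u : bool) : vertex :=
  if m is k.+1 then
    let c := corner a k in if u then (c.1, c.2.+1) else (c.1.+1, c.2)
  else (0, 0).

Definition layer_edge (a : seq nat) (m : nat) (u u' : bool) : edge :=
  (layer_point a m u, layer_point a m.+1 u').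

(* On the two extreme layers, which have a single vertex, only one value of the
   side is accepted, so that the labels of vertices and edges are unique. *)
Definition layer_vertex (a : seq nat) (m : nat) (u : bool) : bool :=
  [&& m <= (num_tiles a).+1, (m == 0) ==> u
    & (m == (num_tiles a).+1) ==> (u == ~~ glued_south a (num_tiles a))].

(** An edge from layer m to layer m+1 leaves the south-west corner of G_(m+1) or enters the
    north-east corner of G_m; only the pair avoiding both corners is excluded. *)
Definition ladder_edge (a : seq nat) (m : nat) (u u' : bool) : bool :=
  [&& m <= num_tiles a, (m == 0) ==> u,
      (m == num_tiles a) ==> (u' == ~~ glued_south a m)
    & (u == glued_south a m) || (u' == ~~ glued_south a m)].

Section Geometry.

Variable a : seq nat.

Local Notation d := (num_tiles a).
Local Notation g := (glued_south a).
Arguments layer_point : simpl never.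

Lemma corner_layer_point m : corner a m = layer_point a m (g m).
Proof. by case: m. Qed.

(** If G_(k+2) lies on top of G_(k+1), this point is the south-east corner of G_(k+2), otherwise its
    north-west corner. For k+1 = d, [corner] places a virtual tile G_(d+1). *)
Lemma north_east_layer_point k :
  ((corner a k).1.+1, (corner a k).2.+1) = layer_point a k.+2 (~~ g k.+1).
Proof.
have -> : layer_point a k.+2 (~~ g k.+1) =
    (let c := if g k.+1 then ((corner a k).1, (corner a k).2.+1)
              else ((corner a k).1.+1, (corner a k).2) in
     if ~~ g k.+1 then (c.1, c.2.+1) else (c.1.+1, c.2)) by [].
by case: (g k.+1).
Qed.

Lemma layer_point_diagonal m u :
  ((layer_point a m u).1 + (layer_point a m u).2)%N = m.
Proof.
have corner_diag k : ((corner a k).1 + (corner a k).2)%N = k.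
  by elim: k => //= k IH; case: ifP => _ /=; rewrite ?addnS ?addSn IH.
by case: m u => [|m] [] //=; rewrite ?addnS ?addSn corner_diag.
Qed.

Lemma layer_point_inj m m' u v :
  layer_point a m u = layer_point a m' v -> m = m' /\ (0 < m -> u = v).
Proof.
move=> eq1.
have eqm : m = m'.
  by rewrite -(layer_point_diagonal m u) eq1 layer_point_diagonal.
rewrite -{}eqm in eq1 *; split=> // m_gt0.
by case: m m_gt0 eq1 => // m _; case: u v => [] [] //= []; lia.
Qed.

Lemma layer_edge_eq m m' u u' v v' :
  layer_edge a m u u' = layer_edge a m' v v' <->
  [/\ m = m', (0 < m -> u = v) & u' = v'].
Proof.
split=> [eqe|[<- equv <-]].
  have [eqm equ] := layer_point_inj (congr1 fst eqe).
  by have [_ ->] := layer_point_inj (congr1 snd eqe).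
by case: m equv => [//|m] ->.
Qed.

Lemma southE k : south (corner a k) = layer_edge a k (g k) false.
Proof. by rewrite /layer_edge -corner_layer_point. Qed.

Lemma westE k : west (corner a k) = layer_edge a k (g k) true.
Proof. by rewrite /layer_edge -corner_layer_point. Qed.

Lemma northE k : north (corner a k) = layer_edge a k.+1 true (~~ g k.+1).
Proof. by rewrite /layer_edge -north_east_layer_point. Qed.

Lemma eastE k : east (corner a k) = layer_edge a k.+1 false (~~ g k.+1).
Proof. by rewrite /layer_edge -north_east_layer_point. Qed.

Lemma tile_edgesP (k : 'I_d) e :
  reflect (exists u, e = layer_edge a k (g k) u \/
                     e = layer_edge a k.+1 u (~~ g k.+1))
          (e \in tile_edges k).
Proof.
rewrite /tile_edges /square_edges southE westE northE eastE !inE.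
apply: (iffP idP) => [|[[] [] ->]]; rewrite ?eqxx ?orbT //.
by do ![case/orP] => /eqP ->; do [by exists true; auto | by exists false; auto].
Qed.

Lemma snake_edgesP e : 0 < d ->
  reflect (exists m u u', ladder_edge a m u u' /\ e = layer_edge a m u u')
          (e \in snake_edges a).
Proof.
move=> d_gt0; apply: (iffP (bigfcupP _ _ _ _)) => [[k _ /tile_edgesP[u]]|].
  case=> ->; [exists k, (g k), u | exists k.+1, u, (~~ g k.+1)];
    split=> //; rewrite /ladder_edge; have := ltn_ord k;
    rewrite ?eqxx ?orbT ?implybT //.
  - move=> ltkd; rewrite (ltnW ltkd) (ltn_eqF ltkd) andbT.
    by case: (nat_of_ord k).
  - by move=> ->.
case=> m [u [u' [/and4P[le_md m0 md] uu' ->]]].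
(* An edge leaving the south-west corner of a tile is assigned to that tile, any other one to the
   previous tile, at whose north-east corner it ends. *)
have [/andP[lt_md /eqP ->]|Hn] := boolP ((m < d) && (u == g m)).
  exists (Ordinal lt_md); first by rewrite mem_index_enum.
  by apply/tile_edgesP; exists u'; left.
case: m => [|m] in le_md m0 md uu' Hn *.
  by case/negP: Hn; rewrite d_gt0; move: m0 => /= ->.
exists (Ordinal le_md); first by rewrite mem_index_enum.
apply/tile_edgesP; exists u; right; congr layer_edge.
apply/eqP; case/orP: uu' => // /eqP equ; move: Hn md.
rewrite equ eqxx andbT -leqNgt => le_dm.
by have -> : m.+1 == d by rewrite eqn_leq le_md.
Qed.

Lemma glue_edgeE j : glue_edge a j = layer_edge a j (g j) (~~ g j).
Proof. by rewrite /glue_edge; case: ifP => gj; rewrite ?southE ?westE gj. Qed.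

Lemma interior_edgesP e :
  reflect (exists2 j, 0 < j < d & e = layer_edge a j (g j) (~~ g j))
          (e \in interior_edges a).
Proof.
rewrite /interior_edges; apply: (iffP (imfsetP _ _ _ _)) => /= -[].
  move=> _ /mapP[j + ->] ->; rewrite mem_iota glue_edgeE => lt_jd.
  by exists j => //; lia.
move=> j lt_jd ->; exists (glue_edge a j); last by rewrite glue_edgeE.
by apply: map_f; rewrite mem_iota; lia.
Qed.

Lemma snake_verticesP v : 0 < d ->
  reflect (exists m u, layer_vertex a m u /\ v = layer_point a m u)
          (v \in snake_vertices a).
Proof.
move=> d_gt0.
have memE m u u' : ladder_edge a m u u' ->
    layer_edge a m u u' \in snake_edges a.
  by move=> ok; apply/snake_edgesP => //; exists m, u, u'.
rewrite /snake_vertices inE; apply: (iffP orP) => [[] /imfsetP[/= e]|].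
- move=> /(snake_edgesP _ d_gt0)[m [u [u' [/and4P[le_md m0 md uu'] ->]]]] ->.
  exists m, u; split=> //; rewrite /layer_vertex m0 (leqW le_md) /=.
  by rewrite (ltn_eqF (_ : m < d.+1)).
- move=> /(snake_edgesP _ d_gt0)[m [u [u' [/and4P[le_md m0 md uu'] ->]]]] ->.
  exists m.+1, u'; split=> //; rewrite /layer_vertex ltnS le_md /= eqSS.
  by apply/implyP => /eqP eqmd; move: md; rewrite -eqmd eqxx.
case=> m [u [/and3P[le_md m0 md] ->]].
have [le_md'|gt_md] := leqP m d.
  left; apply/imfsetP => /=; exists (layer_edge a m u (~~ g m)) => //.
  by apply: memE; rewrite /ladder_edge le_md' m0 eqxx orbT implybT.
right; apply/imfsetP => /=.
have em : m = d.+1 by apply/eqP; rewrite eqn_leq le_md.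
move: md; rewrite em eqxx => /= /eqP ->.
exists (layer_edge a d (g d) (~~ g d)) => //; apply: memE.
by rewrite /ladder_edge leqnn !eqxx (gtn_eqF d_gt0).
Qed.

End Geometry.

(** * Perfect matchings *)

(* b m is the side of the vertex of the layer m that is matched downwards. *)
Definition matching (a : seq nat) (b : nat -> bool) : {fset edge} :=
  [fset layer_edge a m (~~ b m) (b m.+1) | m in iota 0 (num_tiles a).+1].

(** The value at 0 sends the single bottom vertex, labelled [true], upwards; the value at d+1 names
    the north-east corner of G_d. The last clause makes each chosen pair an edge. *)
Definition admissible (a : seq nat) (b : nat -> bool) : Prop :=
  [/\ b 0 = false, b (num_tiles a).+1 = ~~ glued_south a (num_tiles a)
    & forall m, m <= num_tiles a ->
        (~~ b m == glued_south a m) || (b m.+1 == ~~ glued_south a m)].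

Section Matchings.

Variable a : seq nat.

Local Notation d := (num_tiles a).
Local Notation g := (glued_south a).

Hypothesis d_gt0 : 0 < d.

Lemma layer_edge_snake m u u' : (m == 0) ==> u ->
  (layer_edge a m u u' \in snake_edges a) = ladder_edge a m u u'.
Proof.
move=> m0; apply/snake_edgesP/idP => // [[n [v [v' [ok]]]]|ok].
  case/layer_edge_eq => eqm equ ->; rewrite eqm in m0 equ *.
  suff -> : u = v by [].
  case: n {eqm} m0 equ ok => [/= -> _|n _ -> //].
  by case/and4P => _ /= ->.
by exists m, u, u'.
Qed.

Lemma incident_layer m u n w w' :
  reflect ((m = n /\ (0 < m -> u = w)) \/ (m = n.+1 /\ u = w'))
          (incident (layer_point a m u) (layer_edge a n w w')).
Proof.
apply: (iffP orP) => -[].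
- by move/eqP/layer_point_inj => [-> ?]; left.
- by move/eqP/layer_point_inj => [-> H]; right; split=> //; apply: H.
- case=> <- H; left; apply/eqP.
  by case: m H => // m ->.
- by case=> -> ->; right; apply/eqP.
Qed.

Lemma perfect_matchingP P :
  reflect (P `<=` snake_edges a /\
           forall m u, layer_vertex a m u ->
             exists2 e, e \in P /\ incident (layer_point a m u) e &
               forall e', e' \in P -> incident (layer_point a m u) e' -> e' = e)
          (perfect_matching a P).
Proof.
apply: (iffP andP) => -[sub cov]; split=> //.
  move=> m u mu; have /allP/(_ (layer_point a m u)) := cov.
  case/(_ _)/cardfs1P => [|e eE].
    by apply/snake_verticesP => //; exists m, u.
  have memE e' : (e' \in P) && incident (layer_point a m u) e' = (e' == e).
    by move/fsetP/(_ e'): eE; rewrite !inE.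
  exists e; first by apply/andP; rewrite memE.
  by move=> e' e'P inc; apply/eqP; rewrite -memE e'P.
apply/allP => _ /snake_verticesP -/(_ d_gt0)[m [u [mu ->]]].
have [e [eP inc] uniq_e] := cov m u mu.
apply/cardfs1P; exists e; apply/fsetP => e'; rewrite !inE.
apply/andP/eqP => [[]|->]; [exact: uniq_e | by []].
Qed.

Lemma matchingP b e :
  reflect (exists2 m, m <= d & e = layer_edge a m (~~ b m) (b m.+1))
          (e \in matching a b).
Proof.
have iotaE m : m \in iota 0 d.+1 = (m <= d) by rewrite mem_iota.
apply: (iffP (imfsetP _ _ _ _)) => -[m mP ->]; exists m => //.
  by rewrite -iotaE.
by rewrite -iotaE in mP.
Qed.

Lemma mem_matching b m u u' :
  reflect [/\ m <= d, 0 < m -> u = ~~ b m & u' = b m.+1]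
          (layer_edge a m u u' \in matching a b).
Proof.
apply: (iffP (matchingP _ _)) => [[n le_nd /layer_edge_eq[-> equ ->]]|] //.
by case=> le_md equ equ'; exists m => //; apply/layer_edge_eq.
Qed.

Lemma eq_matching b b' : (forall m, m <= d.+1 -> b m = b' m) ->
  matching a b = matching a b'.
Proof.
move=> eq_b; apply/fsetP => e.
by apply/matchingP/matchingP => -[m le_md ->]; exists m;
  rewrite ?eq_b // leqW.
Qed.

Lemma admissible_ladder b m : admissible a b -> m <= d ->
  ladder_edge a m (~~ b m) (b m.+1).
Proof.
case=> b0 bd ok le_md; rewrite /ladder_edge le_md ok // andbT /=.
apply/andP; split; apply/implyP => /eqP ->; first by rewrite b0.
by rewrite bd.
Qed.

(** In layer m, the vertex on side [~~ b m] is covered by the edge going up, the other one by the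
    edge coming from below. *)
Lemma matching_perfect b : admissible a b -> perfect_matching a (matching a b).
Proof.
move=> adm; have [b0 bd ok] := adm; apply/perfect_matchingP; split.
  apply/fsubsetP => e /matchingP[m le_md ->].
  have lad := admissible_ladder adm le_md.
  by rewrite layer_edge_snake //; case/and4P: lad.
move=> m u /and3P[le_md m0 md].
have [eq_u|neq_u] := eqVneq u (~~ b m).
  have {}le_md : m <= d.
    rewrite -ltnS ltn_neqAle le_md andbT; apply: contraTneq md => eqm.
    by rewrite eqm eqxx /= -bd eq_u eqm; case: (b _).
  exists (layer_edge a m (~~ b m) (b m.+1)).
    split; first exact/mem_matching.
    by apply/incident_layer; left.
  move=> _ /matchingP[n le_nd ->] /incident_layer[[<- //]|[eqm]].
  by rewrite eq_u eqm; case: (b _).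
case: m => [|m] in le_md m0 md neq_u *.
  by rewrite b0 (m0 : u = true) in neq_u.
exists (layer_edge a m (~~ b m) (b m.+1)).
  split; first exact/mem_matching.
  by apply/incident_layer; right; move: neq_u; case: (b _) {m0 md} u => [] [].
move=> _ /matchingP[n le_nd ->] /incident_layer[[<- /(_ isT) eq_u]|[[<-] //]].
by rewrite eq_u eqxx in neq_u.
Qed.

(** Upward induction on the layers: the bottom vertex is matched upwards, and once a single edge
    enters a layer, the other vertex of that layer is forced upwards. *)
Lemma perfect_matchingE P : perfect_matching a P ->
  exists2 b, admissible a b & P = matching a b.
Proof.
move=> /perfect_matchingP[/fsubsetP sub cov].
(* The starting side in layer k is not known yet, so both are tried. *)
pose b m := if m is k.+1
  then (layer_edge a k true true \in P) || (layer_edge a k false true \in P)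
  else false.
have layered m : m <= d -> layer_edge a m (~~ b m) (b m.+1) \in P /\
    forall u u', layer_edge a m u u' \in P ->
      (0 < m -> u = ~~ b m) /\ u' = b m.+1.
  elim: m => [|m IH] le_md.
    have [|e [eP inc] uniq_e] := cov 0 true.
      by rewrite /layer_vertex.
    have /(snake_edgesP _ d_gt0) [n [w [w' [_ e_def]]]] := sub _ eP.
    rewrite e_def in eP inc uniq_e.
    case/incident_layer: inc => [[/esym n0 _]|[] //]; rewrite n0 in eP uniq_e.
    have all0 u u' : layer_edge a 0 u u' \in P -> u' = w'.
      move=> uP.
      have inc : incident (layer_point a 0 true) (layer_edge a 0 u u').
        by apply/incident_layer; left.
      by case/layer_edge_eq: (uniq_e _ uP inc).
    have bE : b 1 = w'.
      rewrite /b; case: w' eP {uniq_e e_def} all0 => eP all0.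
        by case: w eP => ->; rewrite ?orbT.
      by apply/norP; split; apply/negP => /all0.
    split=> [|u u' /all0]; rewrite bE //.
  have [prevP prev_uniq] := IH (ltnW le_md).
  have [|e [eP inc] uniq_e] := cov m.+1 (~~ b m.+1).
    by rewrite /layer_vertex (leqW le_md) /= eqSS (ltn_eqF le_md).
  have /(snake_edgesP _ d_gt0) [n [w [w' [_ e_def]]]] := sub _ eP.
  rewrite e_def in eP inc uniq_e.
  case/incident_layer: inc =>
    [[/esym eqn /(_ isT) /esym eqw]|[[/esym eqn] eqw']]; last first.
    rewrite eqn in eP; have [_] := prev_uniq _ _ eP.
    by rewrite -eqw'; case: (b m.+1).
  rewrite {}eqn {}eqw in eP uniq_e.
  have all_m u u' : layer_edge a m.+1 u u' \in P -> u = ~~ b m.+1 /\ u' = w'.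
    move=> uP; have [eq_u|neq_u] := eqVneq u (~~ b m.+1).
      have inc : incident (layer_point a m.+1 (~~ b m.+1))
          (layer_edge a m.+1 u u').
        by rewrite -eq_u; apply/incident_layer; left.
      by case/layer_edge_eq: (uniq_e _ uP inc).
    (* An edge going up from the vertex entered from below would cover it twice. *)
    have [|e' _ uniq_e'] := cov m.+1 (b m.+1).
      by rewrite /layer_vertex (leqW le_md) /= eqSS (ltn_eqF le_md).
    have inc1 : incident (layer_point a m.+1 (b m.+1)) (layer_edge a m.+1 u u').
      by apply/incident_layer; left; move: neq_u {uP};
         case: (b m.+1) u => [] [].
    have inc2 : incident (layer_point a m.+1 (b m.+1))
        (layer_edge a m (~~ b m) (b m.+1)) by apply/incident_layer; right.
    have := etrans (uniq_e' _ uP inc1) (esym (uniq_e' _ prevP inc2)).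
    by case/layer_edge_eq => /eqP; rewrite (gtn_eqF (ltnSn m)).
  have bE : b m.+2 = w'.
    rewrite [LHS]/=; case: w' eP {uniq_e e_def} all_m => eP all_m.
      by case: (~~ b m.+1) eP => ->; rewrite ?orbT.
    by apply/norP; split; apply/negP => /all_m[].
  split=> [|u u' /all_m[]]; rewrite bE //.
have adm : admissible a b.
  have lad m : m <= d -> ladder_edge a m (~~ b m) (b m.+1).
    move=> le_md; rewrite -layer_edge_snake; last by case: (m).
    by apply: sub; case: (layered m le_md).
  split=> // [|m /lad /and4P[] //].
  by have /and4P[_ _ + _] := lad d (leqnn d); rewrite eqxx => /eqP.
exists b => //; apply/fsetP => e; apply/idP/matchingP => [eP|[m le_md ->]].
  have /(snake_edgesP _ d_gt0) [m [u [u' [lad e_def]]]] := sub _ eP.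
  have le_md : m <= d by case/and4P: lad.
  exists m => //; rewrite e_def in eP *.
  by have [_ /(_ _ _ eP)[equ ->]] := layered m le_md; apply/layer_edge_eq.
by case: (layered m le_md).
Qed.

Lemma mem_perfect_matchings P :
  (P \in perfect_matchings a) = perfect_matching a P.
Proof.
rewrite !inE fpowersetE andb_idl //.
by case/andP.
Qed.

End Matchings.

(** * Enclosed tiles *)

(* The matching encoded by the sequence t of enclosure indicators of the tiles
   G_1, ..., G_d; past the end, the default value makes the last layer come
   out right. *)
Definition side (a : seq nat) (t : bitseq) (m : nat) : bool :=
  if m is k.+1 then nth (~~ sgn a (num_tiles a)) t k (+) odd k else false.

Lemma mem_symdiff (P Q : {fset edge}) e :
  (e \in symdiff P Q) = (e \in P) (+) (e \in Q).
Proof. by rewrite !inE; case: (e \in P); case: (e \in Q). Qed.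

Section Enclosure.

Variable a : seq nat.

Local Notation d := (num_tiles a).
Local Notation g := (glued_south a).

Hypothesis d_gt0 : 0 < d.
Hypothesis sgn0 : sgn a 0.

(** Equal consecutive signs toggle the gluing direction and distinct ones keep it, so
    [g k (+) odd k] changes exactly when the sign does. *)
Lemma glued_southE k : g k = sgn a k (+) odd k.
Proof.
elim: k => [|k IH]; first by rewrite sgn0.
by rewrite [LHS]/= IH /=; case: (sgn a k) (sgn a k.+1) (odd k) => [] [] [].
Qed.

Section Membership.

Variable b : nat -> bool.
Hypothesis adm : admissible a b.

(** The condition on u selects the boundary edges at the south-west corner of G_(k+1). Such an edge
    is the only one reaching its upper end from below. *)
Lemma mem_matching_low k u : k < d -> (0 < k -> u = g k) ->
  (layer_edge a k (g k) u \in matching a b) = (u == b k.+1).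
Proof.
move=> lt_kd equ; have [b0 _ ok] := adm.
apply/mem_matching/eqP => [[] //|eq_u]; split=> //; first exact: ltnW.
move=> k_gt0; have := ok k (ltnW lt_kd); rewrite -eq_u equ //.
by case: (g k) (b k) => [] [].
Qed.

(** Dually, a boundary edge at the north-east corner of G_(k+1) is the only edge going up from its
    lower end. *)
Lemma mem_matching_high k u : k < d -> (k.+1 < d -> u = ~~ g k.+1) ->
  (layer_edge a k.+1 u (~~ g k.+1) \in matching a b) = (u == ~~ b k.+1).
Proof.
move=> lt_kd equ; have [_ bd ok] := adm.
apply/mem_matching/eqP => [[_ + _]|eq_u]; first exact.
split=> //; have := ok _ lt_kd.
have [lt_k1d|le_dk] := ltnP k.+1 d; last first.
  by have -> : k.+1 = d by [lia]; rewrite bd.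
move: (equ lt_k1d); rewrite eq_u.
by case: (g k.+1) (b k.+1) (b k.+2) => [] [] [].
Qed.

(** For k > 0 three pairs of sides are allowed, and among them only the glued edge has
    [b k = b k.+1]. *)
Lemma mem_matching_interior k : k < d ->
  (layer_edge a k (g k) (~~ g k) \in matching a b) =
  (if k == 0 then ~~ b 1 else b k == b k.+1).
Proof.
move=> lt_kd; have [b0 _ ok] := adm.
have [->|k_neq0] := eqVneq k 0.
  by rewrite (mem_matching_low (u := false)) //=; case: (b 1).
apply/mem_matching/eqP => [[_ eq1 eq2]|eq_b].
  by rewrite -eq2 eq1 ?lt0n // negbK.
have := ok k (ltnW lt_kd); rewrite -eq_b => ok_k.
by split; [exact: ltnW | |]; move: ok_k; case: (g k) (b k) => [] [].
Qed.

End Membership.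

Local Notation t0 := (nseq d false).

Lemma side_nseq k : k < d -> side a t0 k.+1 = odd k.
Proof. by move=> lt_kd; rewrite /side nth_nseq lt_kd. Qed.

Lemma side_last t : size t = d -> side a t d.+1 = ~~ g d.
Proof.
move=> szt; rewrite /side nth_default ?szt // glued_southE.
by case: (sgn a d) (odd d) => [] [].
Qed.

Lemma admissible_nseq : admissible a (side a t0).
Proof.
split=> // [|m le_md]; first by rewrite side_last ?size_nseq.
have [->|m_neqd] := eqVneq m d.
  by rewrite side_last ?size_nseq ?eqxx ?orbT.
have lt_md : m < d by lia.
case: m lt_md {le_md m_neqd} => // m lt_md.
rewrite !side_nseq ?(ltnW lt_md) // glued_southE.
by case: (sgn a m.+1) => /=; case: (odd m).
Qed.

(** Avoiding every interior edge makes the sides alternate, and the south edge of G_1 fixes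
    [b 1 = false]; this is the parity pattern in [side]. *)
Lemma minimal_matching_nseq P :
  perfect_matching a P ->
  is_minimal_matching a P = (P == matching a (side a t0)).
Proof.
move=> pmP; have [b adm ->] := perfect_matchingE d_gt0 pmP.
have [b0 bd _] := adm.
rewrite /is_minimal_matching matching_perfect // andTb southE.
have adm0 := admissible_nseq.
apply/andP/eqP => [[/fsubsetP bnd]|->].
  rewrite (mem_matching_low adm d_gt0) // => b1.
  apply: eq_matching => m; rewrite leq_eqVlt => /predU1P[->|].
    by rewrite bd side_last ?size_nseq.
  case: m => [|m]; first by rewrite b0.
  rewrite ltnS => lt_md; rewrite side_nseq //.
  elim: m lt_md => [|m IH] lt_md; first by move: b1; case: (b 1).
  have: layer_edge a m.+1 (g m.+1) (~~ g m.+1) \notin matching a b.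
    apply/negP => /bnd; rewrite inE => /andP[/interior_edgesP nint _].
    by apply: nint; exists m.+1.
  rewrite (mem_matching_interior adm) //= IH ?(ltnW lt_md) //.
  by case: (b _) (odd m) => [] [].
split; last by rewrite (mem_matching_low adm0 d_gt0) // side_nseq.
apply/fsubsetP => e eM; rewrite inE; apply/andP; split; last first.
  by have /andP[/fsubsetP/(_ e eM)] := matching_perfect d_gt0 adm0.
apply/interior_edgesP => -[k /andP[k_gt0 lt_kd] e_def].
move: eM; rewrite e_def mem_matching_interior // gtn_eqF //.
case: k k_gt0 lt_kd {e_def} => // k _ lt_kd.
by rewrite !side_nseq ?(ltnW lt_kd) //=; case: (odd k).
Qed.

Lemma minimal_matchingE : minimal_matching a = matching a (side a t0).
Proof.
have adm0 := admissible_nseq.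
have pm0 := matching_perfect d_gt0 adm0.
rewrite /minimal_matching.
set s := [seq P <- _ | _].
have s_all P : P \in s -> P = matching a (side a t0).
  rewrite mem_filter mem_perfect_matchings => /andP[+ pmP].
  by rewrite minimal_matching_nseq // => /eqP.
have : matching a (side a t0) \in s.
  by rewrite mem_filter mem_perfect_matchings minimal_matching_nseq // eqxx.
by case: s s_all => //= P s s_all _; apply: s_all; rewrite mem_head.
Qed.

Section Tiles.

Variable t : bitseq.
Hypothesis adm : admissible a (side a t).
Hypothesis szt : size t = d.

Local Notation S := (symdiff (matching a (side a t)) (minimal_matching a)).
Local Notation T := (nth false t).

Lemma sideT k : k < d -> side a t k.+1 = T k (+) odd k.
Proof. by move=> lt_kd; rewrite /side (set_nth_default false) ?szt. Qed.

(** The side on layer k+1 differs from that of P_- exactly when [T k] holds. This lemma and the next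
    two thus present S as the mod 2 sum of the boundaries of the tiles in T. *)
Lemma symdiff_low k u : k < d -> (0 < k -> u = g k) ->
  (layer_edge a k (g k) u \in S) = T k.
Proof.
move=> lt_kd equ; rewrite mem_symdiff minimal_matchingE.
rewrite !mem_matching_low //; last exact: admissible_nseq.
by rewrite side_nseq // sideT //; case: u (T k) (odd k) {equ} => [] [] [].
Qed.

Lemma symdiff_high k u : k < d -> (k.+1 < d -> u = ~~ g k.+1) ->
  (layer_edge a k.+1 u (~~ g k.+1) \in S) = T k.
Proof.
move=> lt_kd equ; rewrite mem_symdiff minimal_matchingE.
rewrite !mem_matching_high //; last exact: admissible_nseq.
by rewrite side_nseq // sideT //; case: u (T k) (odd k) {equ} => [] [] [].
Qed.

Lemma symdiff_interior k : k.+1 < d ->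
  (layer_edge a k.+1 (g k.+1) (~~ g k.+1) \in S) = T k (+) T k.+1.
Proof.
move=> lt_kd; rewrite mem_symdiff minimal_matchingE.
rewrite !mem_matching_interior //; last exact: admissible_nseq.
rewrite [_ == 0]/= !side_nseq ?sideT ?(ltnW lt_kd) //=.
by case: (T k) (T k.+1) (odd k) => [] [] [].
Qed.

Lemma tile_boundary_symdiff (k : 'I_d) e :
  e \in tile_edges k -> e \in boundary_edges a -> (e \in S) = T k.
Proof.
move=> ek; rewrite inE => /andP[/interior_edgesP nint _].
have lt_kd := ltn_ord k.
case/tile_edgesP: ek nint => u [] -> nint.
  apply: symdiff_low => // k_gt0; apply/eqP/negPn/negP => neq_u.
  apply: nint; exists k; first by rewrite k_gt0.
  by congr layer_edge; case: u (g k) neq_u => [] [].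
apply: symdiff_high => // lt_k1d; apply/eqP/negPn/negP => neq_u.
apply: nint; exists k.+1 => //.
by congr layer_edge; case: u (g k.+1) neq_u => [] [].
Qed.

Lemma tiles_symdiff (k l : 'I_d) e :
  e \in tile_edges k -> e \in tile_edges l -> e \notin S -> T k = T l.
Proof.
wlog le_kl : k l / k <= l.
  move=> th ek el eS; have [/th|/ltnW/th th'] := leqP k l; first exact.
  by apply/esym/th'.
move=> /tile_edgesP[u ek] /tile_edgesP[v el].
case: ek => ek; case: el => el; rewrite ek in el *;
  case/layer_edge_eq: el => eq_l.
- by rewrite eq_l.
- by lia.
- rewrite -eq_l => equ _; rewrite equ // symdiff_interior ?eq_l //.
  by case: (T k) (T l) => [] [].
- by case: eq_l => ->.
Qed.

(** Extended by [false] to the unbounded face, T is constant across every edge outside S, so a tile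
    in T cannot reach that face; a tile not in T has a boundary edge outside S. *)
Lemma enclosedE (k : 'I_d) : enclosed S k = T k.
Proof.
pose label (f : option 'I_d) := if f is Some l then T l else false.
have adj f h : adjacent_off S f h -> label f = label h.
  case/fset0Pn => e; rewrite in_fsetD in_fsetI => /and3P[].
  case: f h => [l|] [m|] //= eS el em.
  - exact: tiles_symdiff el em eS.
  - by rewrite -(tile_boundary_symdiff el em) (negbTE eS).
  - by rewrite -(tile_boundary_symdiff em el) (negbTE eS).
rewrite /enclosed; apply/idP/idP => [nconn|Tk].
  apply: contraR nconn => nTk; apply: connect1.
  (* The edge at the south-west corner other than e_k lies on the boundary. *)
  have ek : layer_edge a k (g k) (g k) \in tile_edges k.
    by apply/tile_edgesP; exists (g k); left.
  apply/fset0Pn; exists (layer_edge a k (g k) (g k)).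
  rewrite in_fsetD in_fsetI symdiff_low // nTk /= ek /=.
  rewrite in_fsetD; apply/andP; split.
    apply/interior_edgesP => -[j _ /layer_edge_eq[<- _]].
    by case: (g k).
  by apply/bigfcupP; exists k; rewrite ?mem_index_enum.
have cl : closed (adjacent_off S) label by move=> f h /adj; rewrite /in_mem.
by apply/negP => /(closed_connect cl); rewrite /in_mem /= Tk.
Qed.

End Tiles.

End Enclosure.

(** * The transfer recursion and the continuant *)

Section Transfer.

Local Open Scope ring_scope.

Variables (K : fieldType) (y : nat -> K) (s : nat -> bool).

(* The components count the order ideals of the first k tiles not containing,
   resp. containing, G_k; starting from (0, 1) amounts to adding a virtual tile
   G_0 that belongs to every ideal. *)
Fixpoint transfer (k : nat) : K * K :=
  if k is i.+1 then
    let: (x, z) := transfer i in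
    if s i then (x + z, y k * z) else (x, y k * (x + z))
  else (0, 1).

(** Among G_(p+1), ..., G_q an ideal picks an initial segment, which is empty if G_p is missing. *)
Lemma transfer_plus p q : (p <= q)%N ->
  (forall k, (p <= k < q)%N -> s k) ->
  transfer q =
    ((transfer p).1 +
       (\sum_(p <= k < q) \prod_(p.+1 <= j < k.+1) y j) * (transfer p).2,
     (\prod_(p.+1 <= j < q.+1) y j) * (transfer p).2).
Proof.
move=> le_pq; rewrite -(subnKC le_pq); elim: (q - p)%N => [|n IH] sP.
  by rewrite addn0 !big_geq // mul0r addr0 mul1r; case: transfer.
rewrite addnS /= IH => [|k kP]; last by apply: sP; lia.
rewrite sP; last by lia.
rewrite (big_nat_recr (p + n)%N p) /=; last by lia.
rewrite (big_nat_recr (p + n).+1 p.+1) /=; last by lia.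
by congr pair; ring.
Qed.

(** Here an ideal picks a final segment, which is everything if G_p is present; y_q is factored out
    of the nonempty segments to leave the sum in [phi]. *)
Lemma transfer_minus p q : (p <= q)%N ->
  (forall k, (p <= k < q)%N -> ~~ s k) ->
  transfer q =
    ((transfer p).1,
     (\prod_(p.+1 <= j < q.+1) y j) * (transfer p).2 +
     y q * (\sum_(p.+1 <= k < q.+1) \prod_(k <= j < q) y j) * (transfer p).1).
Proof.
move=> le_pq; rewrite -(subnKC le_pq); elim: (q - p)%N => [|n IH] sP.
  by rewrite addn0 !big_geq // mulr0 mul0r addr0 mul1r; case: transfer.
rewrite addnS /= IH => [|k kP]; last by apply: sP; lia.
rewrite (negbTE (sP _ _)); last by lia.
do 2![rewrite (big_nat_recr (p + n).+1 p.+1) /=; last by lia].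
have -> : \prod_((p + n).+1 <= j < (p + n).+1) y j = 1 by rewrite big_geq.
have -> : \sum_(p.+1 <= k < (p + n).+1) \prod_(k <= j < (p + n).+1) y j =
    (\sum_(p.+1 <= k < (p + n).+1) \prod_(k <= j < p + n) y j) * y (p + n)%N.
  rewrite mulr_suml; apply: eq_big_nat => k kP.
  by rewrite big_nat_recr //; lia.
by congr pair; ring.
Qed.

End Transfer.

Lemma leq_ell a i j : i <= j -> ell a i <= ell a j.
Proof.
by move=> le_ij; rewrite /ell -(subnKC le_ij) takeD sumn_cat leq_addr.
Qed.

Lemma sgnE a i j : 0 < i <= size a -> ell a i.-1 <= j < ell a i ->
  sgn a j = odd i.
Proof.
move=> iP jP; apply/hasP/idP => [[i' + /andP[odd_i' jP']]|odd_i].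
  rewrite mem_iota => i'P; have [lt_ii'|lt_i'i|-> //] := ltngtP i i'.
    by have := @leq_ell a i i'.-1 ltac:(lia); lia.
  by have := @leq_ell a i' i.-1 ltac:(lia); lia.
by exists i; rewrite ?odd_i // mem_iota; lia.
Qed.

Section Continuant.

Variable a : seq nat.

Local Notation d := (num_tiles a).
Local Notation K := {fraction {mpoly int[d.+1]}}.
Local Notation tr := (transfer (yfrac a) (sgn a)).

Local Open Scope ring_scope.

Lemma yfrac_neq0 j : yfrac a j != 0.
Proof. by rewrite tofrac_eq0 -msupp_eq0 msuppX. Qed.

Let Y k : K := \prod_(1 <= j < k.+1) yfrac a j.

Let Y_neq0 k : Y k != 0.
Proof. by rewrite prodf_seq_neq0; apply/allP => j _; exact: yfrac_neq0. Qed.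

Let YS p q : (p <= q)%N -> Y q = (\prod_(p.+1 <= j < q.+1) yfrac a j) * Y p.
Proof. by move=> le_pq; rewrite /Y mulrC -big_cat_nat. Qed.

Let YC i : ~~ odd i -> (0 < ell a i)%N -> C a i = (Y (ell a i).-1)^-1.
Proof.
by move=> /negbTE even_i l_gt0; rewrite /C even_i prodfV /Y prednK.
Qed.

(** The value 0 before N[] = 1 makes the recursion hold from the first step. *)
Let prev i : K := if i is i'.+1 then continuant (L a) i' else 0.

Let continuantS i :
  continuant (L a) i.+1 = L a i.+1 * continuant (L a) i + prev i.
Proof. by case: i => [|i] //=; rewrite mulr1 addr0. Qed.

Hypothesis a1_gt0 : (0 < nth 0 a 0)%N.

Lemma ell_gt0 i : (0 < i)%N -> (0 < ell a i)%N.
Proof.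
by case: a a1_gt0 i => [|k s] //= k_gt0 [|i] // _; rewrite /ell /=; lia.
Qed.

(** Each block replaces the older of two consecutive continuants. In an odd block [phi] meets the
    carried product Y, which is C; in an even one, factoring out the new Y leaves C. *)
Lemma transfer_ell i : (i <= size a)%N ->
  tr (ell a i) =
    if odd i then (continuant (L a) i, Y (ell a i) * prev i)
    else (prev i, Y (ell a i) * continuant (L a) i).
Proof.
elim: i => [|i IH] lt_i.
  by rewrite /ell take0 /= /Y big_geq // mul1r.
have le_l := leq_ell a (leqnSn i).
have sP k : (ell a i <= k < ell a i.+1)%N -> sgn a k = ~~ odd i.
  by move=> kP; rewrite (@sgnE a i.+1).
rewrite continuantS -[L a i.+1]/(phi a i.+1 * C a i.+1) [prev i.+1]/= oddS.
have [odd_i|even_i] /= := boolP (odd i).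
  rewrite (transfer_minus _ le_l) => [|k kP]; last by rewrite sP ?odd_i.
  rewrite {}IH ?odd_i; last by apply: ltnW.
  (* C for an even index stops at l_i - 1, so the last factor of Y is split off. *)
  have YqE : Y (ell a i.+1) = Y (ell a i.+1).-1 * yfrac a (ell a i.+1).
    have := ell_gt0 (ltn0Sn i); case: (ell a i.+1) => //= m _.
    by rewrite /Y big_nat_recr.
  congr pair; rewrite mulrA -(YS le_l) YC ?oddS ?odd_i ?ell_gt0 // YqE.
  have frac_id (F : fieldType) (u v w c r : F) : u != 0 ->
    u * v * r + v * w * c = u * v * (w / u * c + r) by move=> u_neq0; field.
  by rewrite /phi oddS odd_i /=; apply: frac_id.
rewrite (transfer_plus _ le_l) => [|k kP]; last by rewrite sP ?even_i.
rewrite {}IH ?(negbTE even_i); last by apply: ltnW.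
by rewrite /phi /C oddS even_i /= (YS le_l) -/(Y _) addrC !mulrA.
Qed.

(** Since l_n = d+1, the last block runs one step past G_d, and that step forms the total of both
    components. For even n it also brings the factor y_(d+1), which [inord] sends to ['X_0]; being
    nonzero, it cancels. *)
Lemma transfer_continuant : all (fun k => (0 < k)%N) a ->
  (tr d).1 + (tr d).2 =
    if odd (size a) then continuant (L a) (size a)
    else (C a (size a))^-1 * continuant (L a) (size a).
Proof.
move=> a_pos.
have n_gt0 : (0 < size a)%N by case: a a1_gt0.
have l_gt0 := ell_gt0 n_gt0.
have dP : (ell a (size a).-1 <= d < ell a (size a))%N.
  rewrite /num_tiles prednK // leqnn andbT -ltnS prednK //.
  rewrite -[in ltnRHS](prednK n_gt0) /ell (take_nth 0%N) ?prednK //.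
  rewrite sumn_rcons -[ltnLHS]addn0 ltn_add2l.
  by move/allP: a_pos; apply; rewrite mem_nth ?prednK.
have := transfer_ell (leqnn (size a)).
rewrite -(prednK l_gt0) -/d /= (sgnE (i := size a)) ?n_gt0 ?leqnn //.
case: (tr d) => x z; case: ifP => [_ [<- _] //|odd_n].
rewrite YC ?odd_n // -/d invrK => -[_] /=.
rewrite /Y big_nat_recr //= -/(Y d) => /(canRL (mulKf (yfrac_neq0 _))) ->.
by rewrite [Y d * _]mulrC -mulrA mulKf ?yfrac_neq0.
Qed.

End Continuant.

(** * Order ideals of the fence poset *)

Definition compatible (si p x : bool) : bool := if si then x ==> p else p ==> x.

(** Index m stands for G_m in [true :: t] and for G_(m+1) in [t]. *)
Definition fence_seq (s : nat -> bool) (k : nat) (t : bitseq) : Prop :=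
  forall m, m < k -> compatible (s m) (nth true (true :: t) m) (nth true t m).

(* The indicator sequences of the order ideals of a fence poset; the default
   value true is the entry of the virtual tile G_0. *)
Fixpoint fence_seqs (s : nat -> bool) (k : nat) : seq bitseq :=
  if k is i.+1 then
    [seq rcons t false | t <- fence_seqs s i
                     & compatible (s i) (last true t) false] ++
    [seq rcons t true | t <- fence_seqs s i
                     & compatible (s i) (last true t) true]
  else [:: [::]].

Section Fence.

Variable s : nat -> bool.

Lemma size_fence_seqs k t : t \in fence_seqs s k -> size t = k.
Proof.
elim: k t => [|k IH] t; first by rewrite inE => /eqP ->.
by rewrite mem_cat => /orP[] /mapP[t'];
  rewrite mem_filter => /andP[_ /IH <-] ->; rewrite size_rcons.
Qed.

Lemma fence_seqs_uniq k : uniq (fence_seqs s k).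
Proof.
elim: k => //= k IH; rewrite cat_uniq !(map_inj_uniq (rcons_injl _)).
rewrite !filter_uniq // andbT /=; apply/hasPn => _ /mapP[t _ ->].
by apply/mapP => -[t' _] /rcons_inj[].
Qed.

Lemma mem_fence_seqs k t :
  reflect (size t = k /\ fence_seq s k t) (t \in fence_seqs s k).
Proof.
elim: k t => [|k IH] t.
  rewrite inE; apply: (iffP eqP) => [-> //|[/size0nil ->] //].
have {}IH t' x :
  reflect (size (rcons t' x) = k.+1 /\ fence_seq s k.+1 (rcons t' x))
    ((t' \in fence_seqs s k) && compatible (s k) (last true t') x).
  apply: (iffP andP) => [[/IH[szt ok] okx]|[]].
    rewrite size_rcons szt; split=> // m; rewrite ltnS leq_eqVlt -rcons_cons.
    rewrite !nth_rcons /= szt => /predU1P[->|lt_mk].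
      by rewrite ltnn eqxx ltnSn -[k in nth _ _ k]szt nth_last.
    by rewrite lt_mk ltnS (ltnW lt_mk); apply: ok.
  rewrite size_rcons => -[szt] ok.
  have okS m : m <= k -> compatible (s m) (nth true (true :: t') m)
                           (nth true (rcons t' x) m).
    move=> le_mk; have := ok m; rewrite ltnS -rcons_cons => /(_ le_mk).
    by rewrite nth_rcons /= szt ltnS le_mk.
  split; last first.
    have := okS k (leqnn k); rewrite nth_rcons szt ltnn eqxx.
    by rewrite -[k in nth _ _ k]szt -[size t']/(size (true :: t')).-1 nth_last.
  apply/IH; split=> // m lt_mk; have := okS m (ltnW lt_mk).
  by rewrite nth_rcons szt lt_mk.
rewrite mem_cat; apply: (iffP orP) => [[] /mapP[t' + ->]|].
- by rewrite mem_filter andbC => /IH.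
- by rewrite mem_filter andbC => /IH.
case/lastP: t => [[] //|t' x /IH t'P].
have {}t'P :
    t' \in [seq t <- fence_seqs s k | compatible (s k) (last true t) x].
  by rewrite mem_filter andbC.
by case: x t'P => t'P; [right | left]; apply: map_f.
Qed.

Variables (K : fieldType) (y : nat -> K).

Local Open Scope ring_scope.

Definition weight (t : bitseq) : K := \prod_(k < size t | nth false t k) y k.+1.

Lemma weight_rcons t x :
  weight (rcons t x) = (if x then y (size t).+1 else 1) * weight t.
Proof.
rewrite /weight size_rcons big_mkcond big_ord_recr /= nth_rcons ltnn eqxx mulrC.
congr (_ * _); rewrite [RHS]big_mkcond; apply: eq_bigr => k _.
by rewrite nth_rcons ltn_ord.
Qed.

Lemma transferE k :
  transfer y s k = (\sum_(t <- fence_seqs s k | ~~ last true t) weight t,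
                    \sum_(t <- fence_seqs s k | last true t) weight t).
Proof.
elim: k => [|k IH].
  by rewrite /= !big_cons !big_nil /weight big_ord0 addr0.
have step x : \sum_(t <- fence_seqs s k.+1 | last true t == x) weight t =
    (if x then y k.+1 else 1) *
    \sum_(t <- fence_seqs s k | compatible (s k) (last true t) x) weight t.
  rewrite [fence_seqs s k.+1]/= big_cat !big_map !big_filter_cond /=.
  rewrite mulr_sumr.
  have E z : \sum_(t <- fence_seqs s k | compatible (s k) (last true t) z &&
               (last true (rcons t z) == x)) weight (rcons t z) =
     if z == x then
       \sum_(t <- fence_seqs s k | compatible (s k) (last true t) x)
          (if x then y k.+1 else 1) * weight t else 0.
    have [<-|neq] := eqVneq z x; last first.
      by rewrite big_pred0 // => t; rewrite last_rcons (negbTE neq) andbF.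
    rewrite big_seq_cond [RHS]big_seq_cond; apply: eq_big => t.
      by rewrite last_rcons eqxx andbT.
    by case/andP => /size_fence_seqs szt _; rewrite weight_rcons szt.
  by rewrite !E; case: x {E}; rewrite ?add0r ?addr0.
have stepF : \sum_(t <- fence_seqs s k.+1 | ~~ last true t) weight t =
    \sum_(t <- fence_seqs s k | compatible (s k) (last true t) false) weight t.
  by rewrite -[RHS]mul1r -(step false); apply: eq_bigl => t; rewrite eqbF_neg.
have stepT : \sum_(t <- fence_seqs s k.+1 | last true t) weight t =
    y k.+1 *
    \sum_(t <- fence_seqs s k | compatible (s k) (last true t) true) weight t.
  by rewrite -(step true); apply: eq_bigl => t; rewrite eqb_id.
rewrite stepT stepF /= IH.
(* The total of both components belongs to the entry that s k never forbids: [false] for +, [true]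
   for -. *)
have split_sum : \sum_(t <- fence_seqs s k) weight t =
  \sum_(t <- fence_seqs s k | ~~ last true t) weight t +
  \sum_(t <- fence_seqs s k | last true t) weight t.
  by rewrite (bigID (fun t => last true t)) /= addrC.
case: (s k); rewrite -split_sum /compatible.
  by congr (_, _ * _); apply: eq_bigl => t; case: last.
by congr (_, _ * _); apply: eq_bigl => t; case: last.
Qed.

End Fence.

(** * Perfect matchings as order ideals *)

Section Main.

Variable a : seq nat.

Local Notation d := (num_tiles a).
Local Notation g := (glued_south a).

Hypothesis d_gt0 : 0 < d.
Hypothesis sgn0 : sgn a 0.

(** The pair of sides excluded by the ladder is b m = b (m+1) = g m. With the parities removed, it
    says that the indicator of G_(m+1) is s_m and that of G_m is not. *)
Lemma side_compatible t m : size t = d -> 0 < m < d ->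
  compatible (sgn a m) (nth true (true :: t) m) (nth true t m) =
  ((~~ side a t m == g m) || (side a t m.+1 == ~~ g m)).
Proof.
case: m => // m szt lt_md; rewrite glued_southE // /side.
rewrite !(set_nth_default true (~~ sgn a d)) ?szt ?(ltnW lt_md) //= /compatible.
by case: (sgn a m.+1) (nth true t m) (nth true t m.+1) (odd m) => [] [] [] [].
Qed.

Lemma admissible_sideP t : size t = d ->
  admissible a (side a t) <-> fence_seq (sgn a) d t.
Proof.
move=> szt; split=> [[_ _ ok] m lt_md|ok].
  (* As s_0 = +, the virtual tile G_0 puts no constraint on G_1. *)
  case: m lt_md => [|m] lt_md; first by rewrite sgn0 /compatible /= implybT.
  by rewrite side_compatible // ok // ltnW.
split=> [//||m le_md]; first exact: side_last.
case: m => [|m] in le_md *; first by [].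
have [eq_md|neq_md] := eqVneq m.+1 d.
  by rewrite eq_md side_last // eqxx orbT.
by rewrite -side_compatible ?ok //; lia.
Qed.

Lemma admissible_fence b : admissible a b ->
  exists2 t, t \in fence_seqs (sgn a) d &
    matching a b = matching a (side a t).
Proof.
(* Adding the parity again undoes the twist in [side]. *)
move=> adm; pose t := mkseq (fun k => b k.+1 (+) odd k) d.
have szt : size t = d by rewrite size_mkseq.
have sideE m : m <= d.+1 -> b m = side a t m.
  have [b0 bd _] := adm.
  rewrite leq_eqVlt => /predU1P[->|]; first by rewrite side_last // bd.
  case: m => // m; rewrite ltnS => lt_md.
  by rewrite /side nth_mkseq // addbK.
exists t; last exact: eq_matching.
apply/mem_fence_seqs; split=> //; apply/admissible_sideP => //.
case: adm => b0 bd ok; split; rewrite -?sideE //.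
by move=> m le_md; rewrite -!sideE ?ok // leqW.
Qed.

Lemma perfect_matchings_fence :
  perm_eq (perfect_matchings a)
    [seq matching a (side a t) | t <- fence_seqs (sgn a) d].
Proof.
have admP t : t \in fence_seqs (sgn a) d -> admissible a (side a t).
  by case/mem_fence_seqs => szt ok; apply/admissible_sideP.
apply: uniq_perm; first exact: fset_uniq.
  rewrite map_inj_in_uniq ?fence_seqs_uniq // => t t' tP t'P eqM.
  (* Injectivity: t is recovered from its matching by [enclosedE]. *)
  have [szt szt'] := (size_fence_seqs tP, size_fence_seqs t'P).
  apply: (@eq_from_nth _ false) => [|k]; rewrite szt ?szt' // => lt_kd.
  by rewrite -(enclosedE d_gt0 sgn0 (admP _ tP) szt (Ordinal lt_kd)) eqM
             (enclosedE d_gt0 sgn0 (admP _ t'P) szt').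
move=> P; rewrite mem_perfect_matchings; apply/idP/mapP => [|[t tP ->]].
  case/perfect_matchingE => // b /admissible_fence[t tP eqb] ->.
  by exists t.
by apply: matching_perfect => //; apply: admP.
Qed.

Lemma height_side t : t \in fence_seqs (sgn a) d ->
  tofrac (height a (matching a (side a t))) = weight (yfrac a) t.
Proof.
move=> tP; have [szt ok] := mem_fence_seqs _ _ _ tP.
rewrite /height rmorph_prod /weight szt.
apply: eq_bigl => k; apply: enclosedE => //.
by apply/admissible_sideP.
Qed.

Lemma F_polynomial_transfer :
  tofrac (F_polynomial a) =
    ((transfer (yfrac a) (sgn a) d).1 + (transfer (yfrac a) (sgn a) d).2)%R.
Proof.
rewrite transferE /F_polynomial rmorph_sum (perm_big _ perfect_matchings_fence).
rewrite big_map [LHS]big_seq (eq_bigr _ height_side) -big_seq /=.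
by rewrite (bigID (fun t => last true t)) /= addrC.
Qed.

End Main.

Local Open Scope ring_scope.

Theorem theorem3p4 (a : seq nat)
    (a_pos : all (fun k => (0 < k)%N) a) (a1_ge2 : (2 <= nth 0 a 0)%N) :
  tofrac (F_polynomial a) =
  (if odd (size a) then continuant (L a) (size a)
   else (C a (size a))^-1 * continuant (L a) (size a)).
Proof.
have a1_gt0 : (0 < nth 0 a 0)%N by apply: ltn_trans a1_ge2.
have n_gt0 : (0 < size a)%N by case: (a) a1_gt0.
(* This guarantees that the graph has at least one tile. *)
have l1_ge2 : (2 <= ell a 1)%N.
  by case: (a) a1_ge2 => // k s; rewrite /ell /= take0 /= addn0.
have d_gt0 : (0 < num_tiles a)%N.
  by have := leq_ell a n_gt0; rewrite /num_tiles; lia.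
have sgn0 : sgn a 0.
  by rewrite (@sgnE a 1%N) ?n_gt0 //= /ell take0 /= (ltn_trans _ l1_ge2).
by rewrite F_polynomial_transfer // transfer_continuant.
Qed.
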